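(* Let $\mathcal{G}$ be a DAG on $X_1,\dots,X_d$ and let $P$ be the distribution of an ICM generative process with respect to $\mathcal{G}$. Let $N\ge1$, $n\in[N]$, $\mathbf{I}\subseteq[d]$, and let the intervention set be $\mathbf{X}=\mathbf{X}_{\mathbf{I};n}:=\{X_{i;n}: i\in\mathbf{I}\}$ with realization $\hat{\mathbf{x}}$. Let $\mathbf{S}\subseteq[N]$ with $n\notin\mathbf{S}$, and let $\mathbf{X}_{\neg\mathbf{I};n}:=\{X_{i;n}: i\in[d]\setminus\mathbf{I}\}$. Then $$P(\mathbf{X}_{\neg\mathbf{I};n}\mid do(\mathbf{X}_{\mathbf{I};n}=\hat{\mathbf{x}}),\mathbf{X}_{:;\mathbf{S}})=\prod_{i\notin\mathbf{I}}P\big(X_{i;n}\mid\mathbf{X}_{i;\mathbf{S}},\mathbf{PA}_{i;\mathbf{S}\cup\{n\}}\big)\Big|_{\mathbf{X}_{\mathbf{I};n}=\hat{\mathbf{x}}},$$ where the left-hand side is the conditional distribution of $\mathbf{X}_{\neg\mathbf{I};n}$ given $\mathbf{X}_{:;\mathbf{S}}$ under the post-interventional distribution $P(\cdot\mid do(\mathbf{X}_{\mathbf{I};n}=\hat{\mathbf{x}}))$, the conditionals on the right-hand side are those of the observational distribution $P$, and $|_{\mathbf{X}_{\mathbf{I};n}=\hat{\mathbf{x}}}$ means that every occurrence of a variable of $\mathbf{X}_{\mathbf{I};n}$ (among the parents at position $n$) takes its value in $\hat{\mathbf{x}}$.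
   Context: Notation. $[N]:=\{1,\dots,N\}$. $\{\mathbf{X}_{:;n}\}_{n\in\mathbb{N}}$ is a sequence of arrays $\mathbf{X}_{:;n}=(X_{1;n},\dots,X_{d;n})$, where $X_{i;n}$ is the $i$-th variable (variable index $i$) at position $n$. For a set of positions $S$, $\mathbf{X}_{i;S}:=(X_{i;n})_{n\in S}$ and $\mathbf{X}_{:;S}:=(\mathbf{X}_{:;n})_{n\in S}$. In a DAG $\mathcal{G}$ on $X_1,\dots,X_d$, $\mathbf{PA}_i$ denotes the parents of $X_i$, $\mathbf{ND}_i$ its non-descendants, and $\overline{\mathbf{ND}}_i$ its non-descendants excluding its parents. $\mathbf{PA}_{i;n}$ (also $\mathbf{PA}^{\mathcal{G}}_{i;n}$) denotes $\{X_{j;n}: X_j\in\mathbf{PA}_i\}$, $\mathbf{PA}_{i;S}=(\mathbf{PA}_{i;n})_{n\in S}$, similarly for $\mathbf{ND}$ and $\overline{\mathbf{ND}}$; lowercase letters denote realizations. ICM generative process. Data are generated from an ICM generative process with respect to $\mathcal{G}$ if $\{\mathbf{X}_{:;n}\}$ is infinitely exchangeable (the law of $(\mathbf{X}_{:;1},\dots,\mathbf{X}_{:;N})$ is invariant under permutations of positions, for every $N$) and $\mathbf{X}_{i;[n]}$ is conditionally independent of $(\overline{\mathbf{ND}}_{i;[n]},\mathbf{ND}_{i;n+1})$ given $\mathbf{PA}_{i;[n]}$ for all $i\in[d]$, $n\in\mathbb{N}$. By the (known) causal de Finetti theorems this is equivalent to the representation, for every $N$, $$p(\mathbf{x}_{:;[N]})=\int\cdots\int\prod_{n=1}^{N}\prod_{i=1}^{d}p(x_{i;n}\mid\mathbf{pa}^{\mathcal{G}}_{i;n},\boldsymbol{\theta}_i)\,d\nu_1(\boldsymbol{\theta}_1)\cdots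 d\nu_d(\boldsymbol{\theta}_d)\qquad(\ast)$$ for some probability measures $\nu_1,\dots,\nu_d$ and conditional densities $p(\cdot\mid\cdot,\boldsymbol{\theta}_i)$; this representation may be taken as the definition. Every probability measure is assumed to have a density. Intervention. For a set $\mathbf{X}$ of variables and realization $\hat{\mathbf{x}}$, the post-interventional distribution $P(\cdot\mid do(\mathbf{X}=\hat{\mathbf{x}}))$ is the one obtained from $(\ast)$ by replacing, for every $X_{i;n}\in\mathbf{X}$, the factor $p(x_{i;n}\mid\mathbf{pa}^{\mathcal{G}}_{i;n},\boldsymbol{\theta}_i)$ by the point mass $\delta(X_{i;n}=\hat{x}_{i;n})$, and substituting $\mathbf{X}=\hat{\mathbf{x}}$ in the remaining conditional densities. Conventions. Distributions are identified with their densities; conditionals appearing in the claim are assumed well defined, i.e. the identity is read at points where the conditioning values have positive density. *)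

(* Defs.v *)
From HB Require Import structures.
From mathcomp Require Import all_boot all_order all_algebra.
From mathcomp Require Import all_classical all_reals all_analysis.

Set Implicit Arguments.
Unset Strict Implicit.
Unset Printing Implicit Defensive.

Import Order.TTheory GRing.Theory Num.Theory.

Local Open Scope classical_set_scope.
Local Open Scope ring_scope.

(* [e j i] is the edge X_j -> X_i. *)
Definition dag (d : nat) (e : rel 'I_d) : Prop :=
  forall i j, e i j -> ~~ connect e j i.

Definition cylinders (J : Type) (dU : J -> measure_display)
    (U : forall j, measurableType (dU j)) : set (set (forall j, U j)) :=
  [set C | exists (j : J) (A : set (U j)),
     measurable A /\ C = [set x | A (x j)]].
Arguments cylinders {J dU} U.

Definition prodType (J : Type) (dU : J -> measure_display)
    (U : forall j, measurableType (dU j)) :=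
  g_sigma_algebraType (cylinders U).

(* The integral of [f] over the coordinates listed in [s], the head of [s]
   outermost; the other coordinates keep the values they have in the argument
   of [iterint m s f]. *)
Definition iterint (R : realType) (J : finType) (dU : J -> measure_display)
    (U : forall j, measurableType (dU j))
    (m : forall j, {measure set (U j) -> \bar R}) (s : seq J)
    (f : (forall j, U j) -> \bar R) : (forall j, U j) -> \bar R :=
  foldr (fun j g x => (\int[m j]_u g (@dfwith J U x j u))%E) f s.

(* [x] is the realization of the coordinates in [A]; its other coordinates are
   integrated out. *)
Definition marginal (R : realType) (J : finType) (dU : J -> measure_display)
    (U : forall j, measurableType (dU j))
    (m : forall j, {measure set (U j) -> \bar R})
    (f : (forall j, U j) -> \bar R) (A : {set J}) (x : forall j, U j) :
    \bar R :=
  iterint m (enum (~: A)%SET) f x.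

(* The conditional density of the coordinates in [A] given those in [B]; it is
   meaningful only where the density of [B] lies strictly between 0 and +oo. *)
Definition conditional (R : realType) (J : finType)
    (dU : J -> measure_display) (U : forall j, measurableType (dU j))
    (m : forall j, {measure set (U j) -> \bar R})
    (f : (forall j, U j) -> \bar R) (A B : {set J}) (x : forall j, U j) :
    \bar R :=
  (marginal m f (A :|: B)%SET x / marginal m f B x)%E.

Section ICM.
Context (R : realType) (d : nat) (e : rel 'I_d).
Context (dT : 'I_d -> measure_display) (T : forall i, measurableType (dT i)).

Definition parent (i : 'I_d) : Type := {j : 'I_d | e j i}.

Definition paType (i : 'I_d) :=
  prodType (fun j : parent i => T (val j)).

(* The de Finetti representation of an ICM generative process: [X_i] takes
   values in [T i], where densities are taken with respect to [mu i], and
   [kern M i t pa theta] is p(x_i = t | pa_i = pa, theta_i = theta). *)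
Record icm (mu : forall i, {sigma_finite_measure set (T i) -> \bar R}) := Icm {
  dTh : 'I_d -> measure_display;
  Th : forall i, measurableType (dTh i);
  nu : forall i, probability (Th i) R;
  kern : forall i, T i -> paType i -> Th i -> R;
  kern_ge0 : forall i t pa theta, 0 <= @kern i t pa theta;
  kern_measurable : forall i,
    measurable_fun [set: (T i * paType i * Th i)%type]
      (fun z => @kern i z.1.1 z.1.2 z.2);
  kern_int1 : forall i pa theta,
    (\int[mu i]_t (@kern i t pa theta)%:E = 1)%E }.
#[global] Arguments kern {mu} _ i t pa theta.

(* The coordinate [(n, i)] is X_{i;n}; positions and variables are numbered
   from 0. *)
Definition config (N : nat) : Type := forall k : 'I_N * 'I_d, T k.2.

Definition pa (N : nat) (x : config N) (n : 'I_N) (i : 'I_d) : paType i :=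
  fun j : parent i => x (n, val j).
#[global] Arguments pa {N} x n i.

Definition subst (N : nat) (D : {set 'I_N * 'I_d}) (xhat x : config N) :
    config N :=
  fun k => if k \in D then xhat k else x k.

Context (mu : forall i, {sigma_finite_measure set (T i) -> \bar R}).

Definition obs_ref (N : nat) (k : 'I_N * 'I_d) :
    {measure set (T k.2) -> \bar R} :=
  mu k.2.

(* The starting point [point] of the iterated integral is irrelevant: every
   coordinate of theta is integrated. *)
Definition obs_density (M : icm mu) (N : nat) (x : config N) : \bar R :=
  iterint (fun i => nu M i : {measure set _ -> \bar R}) (enum 'I_d)
    (fun theta : forall i, Th M i =>
       (\prod_(n < N) \prod_(i < d)
          kern M i (x (n, i)) (pa x n i) (theta i))%:E)
    point.

(* The law under do(X_D = xhat) has a point mass at [xhat k] for each [k] in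
   [D], hence no density with respect to [obs_ref].  It is represented by its
   density with respect to the product of the measures below: the factor of an
   intervened coordinate is the Dirac mass, whose density is 1. *)
Definition do_ref (N : nat) (D : {set 'I_N * 'I_d}) (xhat : config N)
    (k : 'I_N * 'I_d) : {measure set (T k.2) -> \bar R} :=
  if k \in D then (\d_(xhat k) : {measure set (T k.2) -> \bar R})
  else obs_ref k.

Definition do_density (M : icm mu) (N : nat) (D : {set 'I_N * 'I_d})
    (xhat x : config N) : \bar R :=
  let y := subst D xhat x in
  iterint (fun i => nu M i : {measure set _ -> \bar R}) (enum 'I_d)
    (fun theta : forall i, Th M i =>
       (\prod_(n < N) \prod_(i < d | (n, i) \notin D)
          kern M i (y (n, i)) (pa y n i) (theta i))%:E)
    point.

End ICM.

Section IndexSets.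
Context (d : nat) (e : rel 'I_d) (N : nat).

Definition vars_at (J : {set 'I_d}) (n : 'I_N) : {set 'I_N * 'I_d} :=
  [set k | (k.1 == n) && (k.2 \in J)]%SET.

Definition vars_in (S : {set 'I_N}) : {set 'I_N * 'I_d} :=
  [set k | k.1 \in S]%SET.

Definition var_in (i : 'I_d) (S : {set 'I_N}) : {set 'I_N * 'I_d} :=
  [set k | (k.1 \in S) && (k.2 == i)]%SET.

Definition pa_in (i : 'I_d) (S : {set 'I_N}) : {set 'I_N * 'I_d} :=
  [set k | (k.1 \in S) && e k.2 i]%SET.

End IndexSets.
Arguments vars_in {d N} S.

(* Main.v *)
(* The mixture (causal de Finetti) representation factorizes, since theta_i is
   integrated independently of the others: with
     G_i^P(x) = \int \prod_(n | (n, i) in P) p(x_(i;n) | pa_(i;n), theta_i) dnu_i,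
   the observational density is \prod_i G_i^P for P the set of all coordinates,
   and the interventional one is \prod_i G_i^P for P the set of coordinates that
   are not intervened on.  Integrating out a coordinate (n, i) of P without
   children in P amounts to removing it from P, because only its own kernel
   depends on it.
   By acyclicity this evaluates both marginals on the left-hand side: the ratio
   is \prod_(i notin I) G_i^(S u n) / G_i^S.  For a factor on the right-hand
   side, integrating out the proper descendants of X_i and the positions outside
   S u {n} leaves G_i^(S u n), respectively G_i^S, times the same product over
   the other variables.  The factor of X_i does not depend on the coordinates
   still to be integrated, so it comes out of the integral, and the two
   remaining integrals cancel. *)
Require Import Defs.
From mathcomp Require Import all_boot all_order all_algebra.
From mathcomp Require Import all_classical all_reals all_analysis.
From mathcomp Require Import measurable_realfun.

Import Order.TTheory GRing.Theory Num.Theory.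

Local Open Scope classical_set_scope.
Local Open Scope ring_scope.

(** * Measurability for the cylinder sigma-algebra *)

Section ProductSpaces.
Context (J : Type) (dU : J -> measure_display).
Context (U : forall j, measurableType (dU j)).

Lemma measurable_coord j : measurable_fun setT (fun x : prodType U => x j).
Proof.
move=> _ A mA; rewrite setTI; apply: sub_sigma_algebra.
by exists j, A.
Qed.

Lemma measurable_to_prodType (d : measure_display) (X : measurableType d)
    (f : X -> prodType U) :
  (forall j, measurable_fun setT (fun x => f x j)) -> measurable_fun setT f.
Proof.
move=> mf; apply: (@measurability _ _ X (prodType U) setT f (cylinders U)) => //.
move=> _ [_ [j [A [mA ->]] <-]].
exact: mf.
Qed.

End ProductSpaces.

Lemma dfwith_swap (J : eqType) (U : J -> Type) (x : forall j, U j) j k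
    (u : U j) (v : U k) : j != k ->
  dfwith (dfwith x j u) k v = dfwith (dfwith x k v) j u.
Proof.
move=> jk; apply: functional_extensionality_dep => l.
have [<-|kl] := eqVneq k l.
  by rewrite dfwithin dfwithout// dfwithin.
rewrite dfwithout//; have [<-|jl] := eqVneq j l; first by rewrite !dfwithin.
by rewrite !dfwithout.
Qed.

(** This presents integration over one coordinate as integration over the second factor of a binary
    product, where Tonelli's theorem applies. *)
Lemma measurable_dfwith (J : choiceType) (dU : J -> measure_display)
  (U : forall j, measurableType (dU j)) (j : J) :
  measurable_fun setT
    (fun z : prodType U * U j => dfwith z.1 j z.2 : prodType U).
Proof.
apply: measurable_to_prodType => k.
have [jk|jk] := eqVneq j k.
  case: _ / jk; apply: (eq_measurable_fun snd) => [z _|].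
    by rewrite dfwithin.
  exact: measurable_snd.
apply: (eq_measurable_fun (fun z : prodType U * U j => z.1 k)) => [z _|].
  by rewrite dfwithout.
by apply: (measurableT_comp (@measurable_coord _ _ U k)); exact: measurable_fst.
Qed.

Lemma emeasurable_prod (d : measure_display) (X : measurableType d)
    (R : realType) (K : Type) (s : seq K) (g : K -> X -> \bar R) :
  (forall k, measurable_fun setT (g k)) ->
  measurable_fun setT (fun x => \prod_(k <- s) g k x)%E.
Proof.
move=> mg; elim: s => [|k s IH].
  by under eq_fun do rewrite big_nil; exact: measurable_cst.
under eq_fun do rewrite big_cons.
exact: emeasurable_funM.
Qed.

(** * Tonelli calculus for iterated integrals of nonnegative functions *)

Section IteratedIntegrals.
Local Open Scope ereal_scope.
Context (R : realType) (J : finType) (dU : J -> measure_display).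
Context (U : forall j, measurableType (dU j)).
Context (m : forall j, {sigma_finite_measure set (U j) -> \bar R}).
Implicit Types (s t : seq J) (f g : (forall j, U j) -> \bar R).

(** [iterint] acts on plain dependent functions; the type of [f] here fixes the cylinder
    sigma-algebra on their domain. *)
Definition measurable_on_prod (f : prodType U -> \bar R) : Prop :=
  measurable_fun [set: prodType U] f.

Local Notation int := (iterint m).

Lemma iterint_cat s t f : int (s ++ t) f = int s (int t f).
Proof. by rewrite /iterint foldr_cat. Qed.

Lemma iterint_ge0 s f : (forall x, 0 <= f x) -> forall x, 0 <= int s f x.
Proof.
by move=> f0; elim: s => //= j s IH x; apply: integral_ge0 => u _.
Qed.

Lemma measurable_iterint s f : (forall x, 0 <= f x) ->
  measurable_on_prod f -> measurable_on_prod (int s f).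
Proof.
move=> f0 mf; elim: s => //= j s IH.
apply: (@measurable_fun_fubini_tonelli_F _ _ (prodType U) (U j) R (m j)
  (fun z => int s f (dfwith z.1 j z.2))).
  exact: (measurableT_comp IH (@measurable_dfwith _ _ U j)).
by move=> z; exact: iterint_ge0.
Qed.

Lemma measurable_section f x j : measurable_on_prod f ->
  measurable_fun setT (fun u : U j => f (dfwith x j u)).
Proof.
move=> mf; apply: (measurableT_comp mf).
apply: (measurableT_comp (@measurable_dfwith _ _ U j)
  (g := fun u => (x : prodType U, u))).
by apply: measurable_fun_pair; [exact: measurable_cst|exact: measurable_id].
Qed.

Lemma iterint_swap j k f : (forall x, 0 <= f x) -> measurable_on_prod f ->
  int [:: j; k] f = int [:: k; j] f.
Proof.
move=> f0 mf; have [->//|jk] := eqVneq j k.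
apply/funext => x /=.
under eq_integral do under eq_integral do rewrite dfwith_swap//.
apply: (@fubini_tonelli _ _ _ _ _ (m j) (m k)
  (fun z => f (dfwith (dfwith x k z.2) j z.1))) => [|//].
apply: (measurableT_comp mf).
have mj := @measurable_dfwith _ _ U j.
have mk := @measurable_dfwith _ _ U k.
apply: (measurableT_comp mj
  (g := fun z : U j * U k => (dfwith x k z.2 : prodType U, z.1))).
apply: measurable_fun_pair => /=; last exact: measurable_fst.
apply: (measurableT_comp mk (g := fun z : U j * U k => (x : prodType U, z.2))).
by apply: measurable_fun_pair; [exact: measurable_cst|exact: measurable_snd].
Qed.

(** Adjacent swaps bring any listed coordinate to the front ([front]); matching heads then allows
    induction on the list. *)
Lemma iterint_perm s t f : (forall x, 0 <= f x) -> measurable_on_prod f ->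
  perm_eq s t -> int s f = int t f.
Proof.
move=> f0 mf.
have front j r : j \in r -> int r f = int (j :: rem j r) f.
  elim: r => //= k r IH; rewrite inE; have [->//|kj /= jr] := eqVneq k j.
  have := iterint_swap k j _ (iterint_ge0 (rem j r) f f0)
    (measurable_iterint (rem j r) f f0 mf).
  by rewrite -!iterint_cat/= => <-; rewrite IH.
elim: s t => [|j s IH] t st.
  by have /perm_size/esym/size0nil-> := st.
rewrite (front j t); last by rewrite -(perm_mem st) mem_head.
rewrite /= (IH (rem j t))//.
by rewrite -(perm_cons j) (perm_trans st)// perm_to_rem// -(perm_mem st) mem_head.
Qed.

Lemma iterintZ s c f : (forall x, 0 <= f x) -> measurable_on_prod f ->
  (forall x, 0 <= c x) ->
  (forall x j (u : U j), j \in s -> c (dfwith x j u) = c x) ->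
  int s (fun x => c x * f x) = fun x => c x * int s f x.
Proof.
move=> f0 mf c0; elim: s => //= j s IH cs.
rewrite IH => [|x k u ks]; last by rewrite cs// inE ks orbT.
apply/funext => x.
under eq_integral do rewrite cs ?mem_head//.
rewrite ge0_integralZl//; last by move=> u _; exact: iterint_ge0.
by apply: measurable_section; exact: measurable_iterint.
Qed.

Lemma iterint_prod s (g : forall j, U j -> \bar R) x : uniq s ->
  (forall j u, 0 <= g j u) -> (forall j, measurable_fun setT (g j)) ->
  int s (fun x => \prod_(j <- s) g j (x j)) x = \prod_(j <- s) \int[m j]_u g j u.
Proof.
move=> + g0 mg.
have mp t : measurable_on_prod (fun x => \prod_(j <- t) g j (x j)).
  apply: (@emeasurable_prod _ (prodType U) R _ t (fun j x => g j (x j))) => j.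
  exact: (measurableT_comp (mg j) (@measurable_coord _ _ U j)).
elim: s x => [|j s IH] x /=; first by rewrite !big_nil.
move=> /andP[js us].
rewrite (_ : (fun x => _) =
    fun x => g j (x j) * \prod_(i <- s) g i (x i)); last first.
  by apply/funext => y; rewrite big_cons.
rewrite iterintZ//; first last.
- by move=> y k u ks; rewrite dfwithout//; apply: contraNneq js => <-.
- by move=> y; apply: prode_ge0 => i _; exact: g0.
(* The inner integral has the same value at every starting point, so it is a constant factor for the
   outer one. *)
under eq_integral do rewrite dfwithin IH//.
rewrite ge0_integralZr// ?big_cons//.
by apply: prode_ge0 => i _; exact: integral_ge0.
Qed.

End IteratedIntegrals.

(** * Cancellation in products of extended reals *)

Section ErealProducts.
Local Open Scope ereal_scope.
Context (R : realType).
Implicit Types x y : \bar R.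

(** A zero factor would make the product zero; an infinite [x] times a positive [y] would be
    infinite. *)
Lemma mule_gt0_lty x y : 0 <= x -> 0 <= y -> 0 < x * y < +oo -> 0 < x < +oo.
Proof.
move=> x0 y0 /andP[xy0 xyoo].
have [x_eq0|xn0] := eqVneq x 0; first by move: xy0; rewrite x_eq0 mul0e ltxx.
have [y_eq0|yn0] := eqVneq y 0; first by move: xy0; rewrite y_eq0 mule0 ltxx.
rewrite lt_def xn0 x0/=; case: x x0 xn0 xy0 xyoo => //= [r|] _ _ _.
  by rewrite ltry.
by rewrite gt0_mulye ?ltxx// lt_def yn0.
Qed.

Lemma prode_gt0_lty (K : finType) (b : K -> \bar R) (i : K) :
  (forall i, 0 <= b i) -> 0 < \prod_i b i < +oo -> 0 < b i < +oo.
Proof.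
move=> b0; rewrite (bigD1 i)//=; apply: mule_gt0_lty => //.
by apply: prode_ge0 => j _.
Qed.

(** The [b i] are nonzero reals, so the factors outside [A] cancel in the field; the [a i] may be
    infinite and are kept apart. *)
Lemma prode_div (K : finType) (A : pred K) (a b : K -> \bar R) :
  (forall i, 0 < b i < +oo) ->
  (\prod_(i | A i) a i * \prod_(i | ~~ A i) b i) / \prod_i b i =
  \prod_(i | A i) (a i / b i).
Proof.
move=> bP.
have bE i : b i = (fine (b i))%:E.
  by rewrite fineK// ge0_fin_numE ?ltW//; case/andP: (bP i).
have bn0 i : fine (b i) != 0%R.
  by have /andP[+ _] := bP i; rewrite bE lte_fin => /lt0r_neq0.
have pn0 (C : pred K) : (\prod_(i | C i) fine (b i) != 0)%R.
  by apply/prodf_neq0 => i _.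
have pE (C : pred K) : \prod_(i | C i) b i = (\prod_(i | C i) fine (b i))%:E.
  by rewrite -prodEFin; apply: eq_bigr => i _.
rewrite big_split/= !pE.
have -> : \prod_(i | A i) (b i)^-1 = (\prod_(i | A i) (fine (b i))^-1)%:E.
  rewrite -prodEFin; apply: eq_bigr => i _.
  by rewrite {1}bE inver (negbTE (bn0 i)).
rewrite inver (negbTE (pn0 _)) -muleA -EFinM; congr (_ * _%:E).
rewrite [X in (_ * X^-1)%R](bigID A)/= prodfV invfM mulrCA mulfV ?mulr1//.
Qed.

Lemma divee_mul x y z : 0 <= y -> 0 <= z -> 0 < y * z < +oo ->
  (x * z) / (y * z) = x / y.
Proof.
move=> y0 z0 yz.
have yP := mule_gt0_lty y z y0 z0 yz.
have zP : 0 < z < +oo by apply: (mule_gt0_lty z y) => //; rewrite muleC.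
have [/andP[yp yoo] /andP[zp zoo]] := (yP, zP).
have zf : z \is a fin_num by rewrite ge0_fin_numE.
rewrite inveM; last first.
  apply/inveMP; case: y {yz yP} y0 yp yoo => // r _ + _.
  rewrite lte_fin => /lt0r_neq0 r0.
  case: z {z0 zP zf} zp zoo => // s + _.
  rewrite lte_fin => /lt0r_neq0 s0.
  by rewrite -EFinM !inver mulf_eq0 (negbTE r0) (negbTE s0)/= -EFinM invfM.
by rewrite muleACA divee ?mule1// gt_eqF.
Qed.

End ErealProducts.

(** * Integration over coordinates that the integrand ignores *)

Section IteratedIntegralsInvariance.
Local Open Scope ereal_scope.
Context (R : realType) (J : finType) (dU : J -> measure_display).
Context (U : forall j, measurableType (dU j)).
Context (m : forall j, {measure set (U j) -> \bar R}).

Lemma iterint_invariant s (f : (forall j, U j) -> \bar R) :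
  (forall j, j \in s -> m j setT = 1) ->
  (forall x j (u : U j), j \in s -> f (dfwith x j u) = f x) ->
  iterint m s f = f.
Proof.
elim: s => //= j s IH m1 fs.
rewrite IH => [|k ks|x k u ks]; first last.
- by rewrite fs// inE ks orbT.
- by rewrite m1// inE ks orbT.
apply/funext => x.
under eq_integral do rewrite fs ?mem_head//.
by rewrite integral_cst// m1 ?mem_head// mule1.
Qed.

End IteratedIntegralsInvariance.

(** * Mixtures of kernels and the densities they generate *)

Section ICM.
Local Open Scope ereal_scope.
Context (R : realType) (d : nat) (e : rel 'I_d).
Context (dT : 'I_d -> measure_display) (T : forall i, measurableType (dT i)).
Context (mu : forall i, {sigma_finite_measure set (T i) -> \bar R}).
Context (M : icm e mu) (N : nat).
Implicit Types (P Q A B D : {set 'I_N * 'I_d}) (i : 'I_d) (n : 'I_N).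
Implicit Types (x y z w xhat : config T N).

Local Notation configType := (prodType (fun k : 'I_N * 'I_d => T k.2)).

Definition likelihood P i z (theta : Th M i) : R :=
  (\prod_(n < N | (n, i) \in P) kern M i (z (n, i)) (pa z n i) theta)%R.

(** This is [G_i^P] in the notation of the overview. *)
Definition mixture P i z : \bar R :=
  \int[nu M i]_theta (likelihood P i z theta)%:E.

(** The value may also depend on parents outside [P]; this is how intervened values enter the
    remaining kernels. *)
Definition truncated_density P z : \bar R := \prod_(i < d) mixture P i z.

Lemma likelihood_ge0 P i z theta : (0 <= likelihood P i z theta)%R.
Proof. by apply: prodr_ge0 => n _; exact: kern_ge0. Qed.

Lemma mixture_ge0 P i z : 0 <= mixture P i z.
Proof. by apply: integral_ge0 => theta _; rewrite lee_fin likelihood_ge0. Qed.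

Lemma truncated_density_ge0 P z : 0 <= truncated_density P z.
Proof. by apply: prode_ge0 => i _; exact: mixture_ge0. Qed.

Lemma measurable_pa n i :
  measurable_fun setT (fun z : configType => pa z n i : paType e T i).
Proof.
apply: measurable_to_prodType => j.
exact: (@measurable_coord _ _ (fun k : 'I_N * 'I_d => T k.2) (n, val j)).
Qed.

Lemma measurable_likelihood P i :
  measurable_fun setT
    (fun w : configType * Th M i => (likelihood P i w.1 w.2)).
Proof.
apply: (eq_measurable_fun (fun w : configType * Th M i => \prod_(n < N)
    if (n, i) \in P then kern M i (w.1 (n, i)) (pa w.1 n i) w.2 else 1)%R).
  by move=> w _; rewrite /likelihood (big_mkcond (fun n => (n, i) \in P)).
apply: (@measurable_prod _ _ R setT _ _ (fun n (w : configType * Th M i) =>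
  if (n, i) \in P then kern M i (w.1 (n, i)) (pa w.1 n i) w.2 else 1)%R) => n _.
case: ((n, i) \in P); last exact: measurable_cst.
apply: (measurableT_comp (@kern_measurable _ _ _ _ _ _ M i)
  (g := fun w : configType * Th M i =>
    (w.1 (n, i) : T i, pa w.1 n i : paType e T i, w.2))).
apply: measurable_fun_pair; last exact: measurable_snd.
apply: measurable_fun_pair.
  apply: (measurableT_comp
    (@measurable_coord _ _ (fun k : 'I_N * 'I_d => T k.2) (n, i))).
  exact: measurable_fst.
apply: (measurableT_comp (measurable_pa n i)); exact: measurable_fst.
Qed.

Lemma measurable_mixture P i :
  measurable_fun setT (mixture P i : configType -> \bar R).
Proof.
have mL : measurable_fun setT
    (fun w : configType * Th M i => (likelihood P i w.1 w.2)%:E).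
  by apply/measurable_EFinP; exact: measurable_likelihood.
have L0 (w : configType * Th M i) : 0 <= (likelihood P i w.1 w.2)%:E.
  by rewrite lee_fin likelihood_ge0.
exact: (@measurable_fun_fubini_tonelli_F _ _ _ _ R (nu M i) _ mL L0).
Qed.

Lemma measurable_truncated_density P :
  measurable_fun setT (truncated_density P : configType -> \bar R).
Proof. by apply: emeasurable_prod => i; exact: measurable_mixture. Qed.

(** A kernel reads only the value of its own variable and those of its parents at the same
    position. *)
Lemma eq_likelihood P Q i z w theta :
  (forall n, ((n, i) \in P) = ((n, i) \in Q)) ->
  (forall n j, (n, i) \in P -> (j == i) || e j i -> z (n, j) = w (n, j)) ->
  likelihood P i z theta = likelihood Q i w theta.
Proof.
move=> PQ zw; apply: eq_big => // n nP.
congr kern; first by rewrite zw// eqxx.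
apply: functional_extensionality_dep => j; apply: zw => //.
by rewrite (valP j) orbT.
Qed.

Lemma eq_mixture P Q i z w :
  (forall n, ((n, i) \in P) = ((n, i) \in Q)) ->
  (forall n j, (n, i) \in P -> (j == i) || e j i -> z (n, j) = w (n, j)) ->
  mixture P i z = mixture Q i w.
Proof.
move=> PQ zw; apply: eq_integral => theta _.
by rewrite (eq_likelihood P Q i z w).
Qed.

Lemma mixture_dfwith P i z k (u : T k.2) :
  (forall j, (j == i) || e j i -> (k.1, i) \in P -> k.2 != j) ->
  mixture P i (dfwith z k u) = mixture P i z.
Proof.
move=> kP; apply: eq_mixture => // n j nP ji; rewrite dfwithout//.
by apply/eqP => kE; move: (kP j ji); rewrite kE/= eqxx => /(_ nP).
Qed.

Lemma iterint_theta P z (s : seq 'I_d) :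
  uniq s ->
  iterint (fun i => nu M i : {measure set _ -> \bar R}) s
    (fun theta : forall i, Th M i =>
      (\prod_(i <- s) likelihood P i z (theta i))%:E) point =
  \prod_(i <- s) mixture P i z.
Proof.
move=> us.
have := @iterint_prod R _ _ (Th M) (fun i => nu M i) s
  (fun i theta => (likelihood P i z theta)%:E) point us.
move=> <-.
- by congr (iterint _ _ _ _); apply/funext => theta; rewrite -prodEFin.
- by move=> i u; rewrite lee_fin likelihood_ge0.
- move=> i; apply/measurable_EFinP.
  apply: (measurableT_comp (measurable_likelihood P i)
    (g := fun theta => (z : configType, theta))).
  by apply: measurable_fun_pair; [exact: measurable_cst|exact: measurable_id].
Qed.

Lemma obs_densityE z :
  obs_density M z = truncated_density [set: 'I_N * 'I_d]%SET z.
Proof.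
rewrite /obs_density /truncated_density -big_enum /= -iterint_theta ?enum_uniq//.
congr (iterint _ _ _ _); apply/funext => theta.
rewrite exchange_big/= big_enum/=; congr (_%:E).
by apply: eq_bigr => i _; apply: eq_bigl => n; rewrite inE.
Qed.

Lemma do_densityE D xhat x :
  do_density M D xhat x = truncated_density (~: D)%SET (subst D xhat x).
Proof.
rewrite /do_density /truncated_density -big_enum /= -iterint_theta ?enum_uniq//.
congr (iterint _ _ _ _); apply/funext => theta.
rewrite big_enum/=; congr (_%:E).
under eq_bigr do rewrite big_mkcond/=.
rewrite exchange_big/=.
apply: eq_bigr => i _; rewrite -big_mkcond/=.
by apply: eq_bigl => n; rewrite inE.
Qed.

(** Only the kernel of [(n, i)] reads this coordinate. Tonelli's theorem moves its integral inside
    the one over [theta], where the kernel integrates to 1. *)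
Lemma truncated_density_sink P n i z : (n, i) \in P ->
  (forall i', e i i' -> (n, i') \notin P) ->
  \int[mu i]_u truncated_density P
    (@dfwith _ (fun k : 'I_N * 'I_d => T k.2) z (n, i) u) =
  truncated_density (P :\ (n, i)) z.
Proof.
move=> niP sink.
pose zu (u : T i) : config T N :=
  @dfwith _ (fun k : 'I_N * 'I_d => T k.2) z (n, i) u.
have zuE n' j u : (n', j) != (n, i) -> zu u (n', j) = z (n', j).
  by move=> nj; rewrite /zu dfwithout// eq_sym.
have zu_in u : zu u (n, i) = u by rewrite /zu dfwithin.
have out i' u : i' != i -> mixture P i' (zu u) = mixture (P :\ (n, i)) i' z.
  move=> i'i; apply: eq_mixture => [n'|n' j n'P ji'].
    by rewrite !inE xpair_eqE (negbTE i'i) andbF.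
  apply: zuE; apply/eqP => -[n'n jE]; subst n' j.
  move: ji'; rewrite eq_sym (negbTE i'i)/= => /sink.
  by rewrite n'P.
rewrite /truncated_density (bigD1 i)//=.
transitivity (\int[mu i]_u (mixture P i (zu u) *
    \prod_(i' < d | i' != i) mixture (P :\ (n, i)) i' z)).
  apply: eq_integral => u _; rewrite (bigD1 i)//=; congr (_ * _).
  by apply: eq_bigr => i' i'i; exact: out.
have mzu : measurable_fun setT (zu : T i -> configType).
  apply: (measurableT_comp
    (@measurable_dfwith _ _ (fun k : 'I_N * 'I_d => T k.2) (n, i))
    (g := fun u => (z : configType, u : T (n, i).2))).
  by apply: measurable_fun_pair; [exact: measurable_cst|exact: measurable_id].
rewrite ge0_integralZr//; first last.
- by apply: prode_ge0 => i' _; exact: mixture_ge0.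
- by move=> u _; exact: mixture_ge0.
- by apply: (measurableT_comp (measurable_mixture P i)); exact: mzu.
congr (_ * _).
rewrite /mixture.
rewrite (@fubini_tonelli _ _ _ _ _ (mu i) (nu M i)
  (fun v => (likelihood P i (zu v.1) v.2)%:E)); first last.
- by move=> v; rewrite lee_fin likelihood_ge0.
- apply/measurable_EFinP; apply: (measurableT_comp (measurable_likelihood P i)
    (g := fun w : T i * Th M i => (zu w.1 : configType, w.2))).
  apply: measurable_fun_pair; last exact: measurable_snd.
  by apply: (measurableT_comp mzu); exact: measurable_fst.
apply: eq_integral => theta _ /=.
have likE u : likelihood P i (zu u) theta =
    (kern M i u (pa z n i) theta * likelihood (P :\ (n, i)) i z theta)%R.
  rewrite {1}/likelihood (bigD1 n)//=; congr (_ * _)%R.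
    rewrite zu_in; congr kern.
    apply: functional_extensionality_dep => j; apply: zuE.
    (* The sink condition at [i] itself excludes a self-loop, so the parents are unaffected by
       [u]. *)
    apply/eqP => -[jE]; have := sink i; rewrite niP.
    by have := valP j; rewrite /= jE => -> /(_ isT).
  rewrite /likelihood; apply: eq_big => [n'|n' /andP[n'P n'n]].
    by rewrite !inE xpair_eqE eqxx andbT andbC.
  congr kern; first by rewrite zuE// xpair_eqE negb_and n'n.
  apply: functional_extensionality_dep => j; apply: zuE.
  by rewrite xpair_eqE negb_and n'n.
under eq_integral do rewrite likE EFinM.
rewrite ge0_integralZr//; first last.
- by rewrite lee_fin likelihood_ge0.
- by move=> u _; rewrite lee_fin kern_ge0.
- apply/measurable_EFinP.
  apply: (measurableT_comp (@kern_measurable _ _ _ _ _ _ M i)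
    (g := fun u : T i => (u, pa z n i : paType e T i, theta))).
  apply: measurable_fun_pair; last exact: measurable_cst.
  by apply: measurable_fun_pair; [exact: measurable_id|exact: measurable_cst].
by rewrite kern_int1 mul1e.
Qed.

(** * Marginals and conditionals for an acyclic graph *)

Context (he : dag e).

(** The inclusion of descendants is strict: [connect] is reflexive, so [i] is among its own
    descendants, while acyclicity keeps it out of those of [j]. *)
Lemma card_descendants_lt i j : e i j ->
  (#|[set k | connect e j k]%SET| < #|[set k | connect e i k]%SET|)%N.
Proof.
move=> ij; apply: proper_card; apply/properP; split.
  apply/fintype.subsetP => k; rewrite !inE; apply: connect_trans; exact: connect1.
by exists i; rewrite !inE ?connect0// he.
Qed.

(** Closure is relative to [P]: with [P] the complement of the intervened coordinates, intervened
    parents need not lie in [Q]. *)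
Definition parent_closed P Q : Prop :=
  forall n i j, e j i -> (n, i) \in Q -> (n, j) \in P -> (n, j) \in Q.

(** Sinks are removed one at a time, by induction on the size of [P :\: Q]. The measures agree with
    [mu] only on the coordinates integrated, which covers both reference measures. *)
Lemma iterint_truncated_density
    (m : forall k : 'I_N * 'I_d, {sigma_finite_measure set (T k.2) -> \bar R})
    P Q :
  Q \subset P -> parent_closed P Q ->
  (forall k, k \in P :\: Q -> m k = mu k.2) ->
  iterint (fun k => m k : {measure set _ -> \bar R}) (enum (P :\: Q)%SET)
    (truncated_density P) = truncated_density Q.
Proof.
elim: {P}_.+1 {-2}P (ltnSn #|P :\: Q|) => // c IH P + QP cl mE.
have [/eqP|[k0 k0PQ]] := set_0Vmem (P :\: Q).
  rewrite finset.setD_eq0 => PQ _.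
  have /eqP <- : P == Q by rewrite finset.eqEsubset PQ QP.
  by rewrite finset.setDv enum_set0.
rewrite ltnS => cP.
(* A coordinate with fewest descendants among those to be integrated out has no
   child in [P]. *)
pose k := [arg min_(k < k0 in P :\: Q) #|[set j | connect e k.2 j]%SET|].
have [kPQ kmin] : k \in P :\: Q /\ forall l, l \in P :\: Q ->
    (#|[set j | connect e k.2 j]%SET| <= #|[set j | connect e l.2 j]%SET|)%N.
  by rewrite /k; case: arg_minnP.
case: k kPQ kmin => n i niPQ imin.
have /setDP[niP niQ] := niPQ.
have sink i' : e i i' -> (n, i') \notin P.
  move=> ii'; apply/negP => i'P.
  have i'Q : (n, i') \notin Q.
    by apply: contra niQ => i'Q; exact: (cl n i' i).
  have /imin : (n, i') \in P :\: Q by rewrite inE i'Q.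
  by rewrite leqNgt card_descendants_lt.
have PkE : (P :\ (n, i)) :\: Q = (P :\: Q) :\ (n, i).
  by apply/setP => l; rewrite !inE andbCA.
have QP' : Q \subset P :\ (n, i) by rewrite subsetD1 QP niQ.
(* The last coordinate of the list is the innermost, so the sink is integrated first. *)
have sE : perm_eq (enum (P :\: Q)) (enum ((P :\ (n, i)) :\: Q) ++ [:: (n, i)]).
  apply: uniq_perm; rewrite ?cats1 ?rcons_uniq ?enum_uniq ?andbT//.
    by rewrite mem_enum !inE eqxx/= andbF.
  move=> l; rewrite mem_rcons in_cons !mem_enum PkE [in RHS]in_setD1.
  by have [->|//] := eqVneq l (n, i).
rewrite (iterint_perm R _ _ _ m _ _ _ (truncated_density_ge0 P)
  (measurable_truncated_density P) sE) iterint_cat/=.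
rewrite (_ : (fun x => _) = truncated_density (P :\ (n, i))); last first.
  apply/funext => z; rewrite -truncated_density_sink//.
  by rewrite mE.
apply: IH => //.
- by move: cP; rewrite PkE (cardsD1 (n, i) (P :\: Q)) niPQ.
- by move=> n' i' j e' Q' /setD1P[_]; exact: (cl n' i' j).
- by move=> l; rewrite PkE => /setD1P[_]; exact: mE.
Qed.

Lemma iterint_subst
    (m : forall k : 'I_N * 'I_d, {measure set (T k.2) -> \bar R})
    (s : seq ('I_N * 'I_d)) D xhat (f : config T N -> \bar R) x :
  (forall k, k \in s -> k \notin D) ->
  iterint m s (fun x => f (subst D xhat x)) x = iterint m s f (subst D xhat x).
Proof.
elim: s x => //= k s IH x sD.
apply: eq_integral => u _; rewrite IH => [|l ls]; last first.
  by rewrite sD// in_cons ls orbT.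
congr iterint; apply: functional_extensionality_dep => l; rewrite /subst.
have [<-|kl] := eqVneq k l.
  by rewrite !dfwithin (negbTE (sD k _)) ?mem_head.
by rewrite !dfwithout.
Qed.

(** [A] need not be closed under parents. The coordinates outside a closed [B] are integrated first
    and disappear; those of [B :\: A] remain to be treated. *)
Lemma marginal_obs A B : A \subset B ->
  parent_closed [set: 'I_N * 'I_d]%SET B ->
  marginal (obs_ref mu (N := N)) (obs_density M (N := N)) A =
  iterint (obs_ref mu (N := N)) (enum (B :\: A)%SET) (truncated_density B).
Proof.
move=> AB cl.
pose m (k : 'I_N * 'I_d) : {sigma_finite_measure set (T k.2) -> \bar R} :=
  mu k.2.
have -> : obs_density M (N := N) = truncated_density [set: 'I_N * 'I_d]%SET.
  by apply/funext => z; rewrite obs_densityE.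
have sE : perm_eq (enum (~: A)%SET)
    (enum (B :\: A)%SET ++ enum ([set: 'I_N * 'I_d] :\: B)%SET).
  apply: uniq_perm; rewrite ?cat_uniq ?enum_uniq ?andbT//=.
    by apply/hasPn => l; rewrite !mem_enum !inE andbT => /negbTE->; rewrite andbF.
  move=> l; rewrite mem_cat !mem_enum !inE andbT.
  have [lA|//] := boolP (l \in A); rewrite /= ?(fintype.subsetP AB _ lA)//.
  by case: (l \in B).
rewrite /marginal (iterint_perm R _ _ _ m _ _ _ (truncated_density_ge0 _)
  (measurable_truncated_density _) sE) iterint_cat.
by rewrite iterint_truncated_density//; exact: finset.subsetT.
Qed.

Lemma marginal_do D xhat A x : A \subset ~: D -> parent_closed (~: D)%SET A ->
  marginal (do_ref mu D xhat) (do_density M D xhat) A x =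
  truncated_density A (subst D xhat x).
Proof.
move=> AD cl.
(* The same measures as [do_ref], with the sigma-finite structure that Tonelli's theorem
   requires. *)
pose m (k : 'I_N * 'I_d) : {sigma_finite_measure set (T k.2) -> \bar R} :=
  if k \in D then (\d_(xhat k) : {sigma_finite_measure set (T k.2) -> \bar R})
  else mu k.2.
have mE : do_ref mu D xhat = fun k => m k : {measure set (T k.2) -> \bar R}.
  apply: functional_extensionality_dep => k; rewrite /do_ref /m.
  by case: ifP.
have -> : do_density M D xhat =
    fun x => truncated_density (~: D)%SET (subst D xhat x).
  by apply/funext => z; rewrite do_densityE.
have msub : measurable_fun setT (subst D xhat : configType -> configType).
  apply: measurable_to_prodType => k; rewrite /subst.
  case: (k \in D); first exact: measurable_cst.
  exact: (@measurable_coord _ _ (fun k : 'I_N * 'I_d => T k.2) k).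
have sE : perm_eq (enum (~: A)%SET) (enum (~: D :\: A)%SET ++ enum D).
  apply: uniq_perm; rewrite ?cat_uniq ?enum_uniq ?andbT//=.
    by apply/hasPn => l; rewrite !mem_enum !inE => ->; rewrite andbF.
  move=> l; rewrite mem_cat !mem_enum !inE.
  have [lA|/=] := boolP (l \in A); last by case: (l \in D).
  by have := fintype.subsetP AD _ lA; rewrite inE => /negbTE->.
rewrite /marginal mE (iterint_perm R _ _ _ m _ _ _ _ _ sE); first last.
- by apply: (measurableT_comp (measurable_truncated_density _)); exact: msub.
- by move=> z; exact: truncated_density_ge0.
(* The intervened coordinates are innermost: [subst] makes the integrand ignore them, and a Dirac
   measure has mass 1. *)
rewrite iterint_cat [X in iterint _ _ X]iterint_invariant; first last.
- move=> z k u; rewrite mem_enum => kD; congr truncated_density.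
  apply: functional_extensionality_dep => l; rewrite /subst.
  case: ifPn => // lD; rewrite dfwithout//.
  by apply: contraNneq lD => <-.
- move=> k; rewrite mem_enum /m => ->.
  by rewrite /= diracT.
rewrite iterint_subst => [|k]; last by rewrite mem_enum !inE => /andP[].
rewrite iterint_truncated_density// => k; rewrite !inE /m.
by move=> /andP[_ /negbTE->].
Qed.

(** Numerator and denominator become mixtures of [i] times the same integral [H]; the bound on the
    denominator makes [H] positive and finite. *)
Lemma conditional_obs n (S : {set 'I_N}) i z : n \notin S ->
  let given := (var_in i S :|: pa_in e i (n |: S))%SET in
  0 < marginal (obs_ref mu (N := N)) (obs_density M (N := N)) given z < +oo ->
  conditional (obs_ref mu (N := N)) (obs_density M (N := N))
    (vars_at [set i]%SET n) given z =
  mixture (vars_in (n |: S)) i z / mixture (vars_in S) i z.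
Proof.
move=> nS A; rewrite /conditional; set B := (vars_at _ n :|: A)%SET.
(* [Q1] and [Q0] are what remains of the two marginals once the proper
   descendants of [X_i] and the positions outside [S] and [n] are integrated
   out; [Q1 :\: B] and [Q0 :\: A] are the same set. *)
pose Q1 := [set k : 'I_N * 'I_d |
  (k.1 \in n |: S) && (~~ connect e i k.2 || (k.2 == i))]%SET.
pose Q0 := (Q1 :\ (n, i))%SET.
have irr : ~~ e i i by apply/negP => ii; have := he i i ii; rewrite connect0.
(* [B] gathers variable [i] and its parents at all positions of [n |: S]; [A] is [B] without
   [(n, i)]. *)
have inB k : (k \in B) = (k.1 \in n |: S) && ((k.2 == i) || e k.2 i).
  rewrite !inE; have [->|_] := eqVneq k.1 n; rewrite /= ?(negbTE nS)//.
  by case: (k.1 \in S).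
have inA k : (k \in A) = (k != (n, i)) && (k \in B).
  rewrite inB !inE -pair_eqE /pair_eq/=.
  have [->|_] := eqVneq k.1 n; rewrite /= ?(negbTE nS)//=.
    by have [->|] := eqVneq k.2 i; rewrite ?(negbTE irr).
  by rewrite andb_orr.
have BQ1 : B \subset Q1.
  apply/fintype.subsetP => k; rewrite inB => /andP[kS]; rewrite inE kS/=.
  by case/orP => [->|ki]; rewrite ?orbT// he.
have AQ0 : A \subset Q0.
  apply/fintype.subsetP => k; rewrite inA => /andP[kni kB].
  by rewrite in_setD1 kni (fintype.subsetP BQ1).
(* A parent of a non-descendant of [i] is again a non-descendant, and a parent of [i] is one by
   acyclicity. *)
have cl1 : parent_closed [set: 'I_N * 'I_d]%SET Q1.
  move=> n' i' j ji' + _; rewrite !inE => /andP[->/=].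
  case/orP => [ii'|/eqP i'i].
    by rewrite (contra _ ii')// => ij; exact: connect_trans ij (connect1 ji').
  by rewrite he//= -i'i.
(* [Q1] contains no child of [i], so removing [(n, i)] preserves closure. *)
have cl0 : parent_closed [set: 'I_N * 'I_d]%SET Q0.
  move=> n' i' j ji' /setD1P[_ i'Q1] jT; rewrite in_setD1 (cl1 n' i' j)// andbT.
  apply/eqP => -[_ jE]; move: i'Q1; rewrite inE/= => /andP[_].
  rewrite jE in ji'; rewrite connect1//= => /eqP i'i.
  by move: irr; rewrite -{2}i'i ji'.
have CE : (Q0 :\: A = Q1 :\: B)%SET.
  apply/setP => k; rewrite finset.in_setD in_setD1 [RHS]finset.in_setD inA.
  have [->|] := eqVneq k (n, i) => //=.
  by rewrite inB/= !inE !eqxx.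
have CP Q : Q \subset vars_in (n |: S) -> forall k, k \in (Q1 :\: B)%SET ->
    forall x (u : T k.2), mixture Q i (dfwith x k u) = mixture Q i x.
  move=> QS k /setDP[_ kB] x u; apply: mixture_dfwith => j ji kQ.
  apply: contra kB => /eqP kj; rewrite inB kj ji andbT.
  by have := fintype.subsetP QS _ kQ; rewrite inE.
(* [Q0] and [Q1] differ only in a coordinate of variable [i], so [r] serves both. *)
pose r x := \prod_(i' < d | i' != i) mixture Q1 i' x.
pose m (k : 'I_N * 'I_d) : {sigma_finite_measure set (T k.2) -> \bar R} :=
  mu k.2.
pose H := iterint (obs_ref mu (N := N)) (enum (Q1 :\: B)%SET) r z.
have r0 x : 0 <= r x by apply: prode_ge0 => i' _; exact: mixture_ge0.
have mr : measurable_on_prod R _ _ (fun k : 'I_N * 'I_d => T k.2) r.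
  rewrite /measurable_on_prod.
  have -> : r = fun x =>
      \prod_(i' <- [seq i' <- index_enum 'I_d | i' != i]) mixture Q1 i' x.
    by apply/funext => x; rewrite big_filter.
  by apply: emeasurable_prod => i'; exact: measurable_mixture.
have split Q Q' : Q \subset vars_in (n |: S) ->
    (forall n', ((n', i) \in Q') = ((n', i) \in Q)) ->
    (forall n' i', i' != i -> ((n', i') \in Q') = ((n', i') \in Q1)) ->
    iterint (obs_ref mu (N := N)) (enum (Q1 :\: B)%SET)
      (truncated_density Q') z = mixture Q i z * H.
  move=> QS QQ' Q'Q1.
  have -> : truncated_density Q' = fun x => mixture Q i x * r x.
    apply/funext => x; rewrite /truncated_density (bigD1 i)//=; congr (_ * _).
      by apply: eq_mixture => //.
    by apply: eq_bigr => i' i'i; apply: eq_mixture => // n'; exact: Q'Q1.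
  have := @iterintZ R _ _ _ m (enum (Q1 :\: B)%SET) (mixture Q i) r r0 mr
    (mixture_ge0 Q i).
  move=> /(_ _)/(congr1 (fun f => f z)) -> // x k u.
  by rewrite mem_enum => kC; exact: CP.
rewrite !(marginal_obs A Q0)// !(marginal_obs B Q1)// CE.
rewrite (split (vars_in S) Q0); first last.
- by move=> n' i' i'i; rewrite in_setD1 xpair_eqE (negbTE i'i) andbF.
- move=> n'; rewrite in_setD1 !inE xpair_eqE eqxx orbT !andbT.
  by have [->|] := eqVneq n' n; rewrite ?(negbTE nS).
- by apply/fintype.subsetP => k; rewrite !inE => ->; rewrite orbT.
rewrite (split (vars_in (n |: S)) Q1)//; last first.
  by move=> n'; rewrite !inE eqxx orbT andbT.
move=> bH; apply: divee_mul => //; first exact: mixture_ge0.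
by apply: (@iterint_ge0 R _ _ _ m).
Qed.

End ICM.
Arguments mixture {R d e dT T mu} M {N} P i z.
Arguments truncated_density {R d e dT T mu} M {N} P z.

Theorem lemma1 (R : realType) (d : nat) (e : rel 'I_d) (he : dag e)
    (dT : 'I_d -> measure_display) (T : forall i, measurableType (dT i))
    (mu : forall i, {sigma_finite_measure set (T i) -> \bar R})
    (M : icm e mu)
    (N : nat) (n : 'I_N) (I : {set 'I_d}) (xhat : config T N)
    (S : {set 'I_N}) (hS : n \notin S)
    (x : config T N) :
  let D := vars_at I n in
  let p := obs_density M (N := N) in
  let pdo := do_density M D xhat in
  let m := obs_ref mu (N := N) in
  let mdo := do_ref mu D xhat in
  let y := subst D xhat x in
  let given i := (var_in i S :|: pa_in e i (n |: S))%SET in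
  (0 < marginal mdo pdo (vars_in S) x < +oo)%E ->
  (forall i, i \notin I -> (0 < marginal m p (given i) y < +oo)%E) ->
  conditional mdo pdo (vars_at (~: I)%SET n) (vars_in S) x =
  (\prod_(i | i \notin I)
     conditional m p (vars_at [set i]%SET n) (given i) y)%E.
Proof.
move=> D p pdo m mdo y given doS obsP.
have SD : vars_in S \subset (~: D)%SET.
  apply/fintype.subsetP => k; rewrite !inE => kS.
  by apply/nandP; left; apply: contraNneq hS => <-.
have QD : (vars_at (~: I) n :|: vars_in S)%SET \subset (~: D)%SET.
  rewrite finset.subUset SD andbT; apply/fintype.subsetP => k; rewrite !inE.
  by case/andP => -> ->.
have mS : marginal mdo pdo (vars_in S) x = truncated_density M (vars_in S) y.
  apply: marginal_do => // n' i j _; by rewrite !inE.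
(* The marginal of [S] is the product of these mixtures, so its bounds pass to each factor. *)
have bP i : (0 < mixture M (vars_in S) i y < +oo)%E.
  apply: (@prode_gt0_lty _ _ (fun i => mixture M (vars_in S) i y)).
    by move=> j; exact: mixture_ge0.
  by move: doS; rewrite mS.
rewrite /conditional mS marginal_do//; last first.
  (* At position [n], a parent outside [D] is not intervened on, hence belongs to the set. *)
  move=> n' i j _; rewrite !inE/=.
  by case: eqP => //= _ _; rewrite ?orbF => ->.
(* Position [n] adds a kernel only for the variables outside [I]; the others keep their mixture over
   [S], which cancels against the denominator. *)
rewrite [X in (X / _)%E](_ : _ =
    (\prod_(i | i \notin I) mixture M (vars_in (n |: S)) i y *
     \prod_(i | ~~ (i \notin I)) mixture M (vars_in S) i y)%E); last first.
  rewrite /truncated_density (bigID (fun i => i \notin I))/=; congr (_ * _)%E.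
    apply: eq_bigr => i iI; apply: eq_mixture => // n'.
    by rewrite !inE/= iI andbT.
  apply: eq_bigr => i; rewrite negbK => iI; apply: eq_mixture => // n'.
  by rewrite !inE/= iI andbF.
rewrite prode_div//; apply: eq_bigr => i iI.
by symmetry; apply: conditional_obs => //; exact: obsP.
Qed.
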